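(* Let $i\in\{0,\dots,N-1\}$ and assume that $\mathbf m_{h,\varepsilon}^i\in\mathcal M_h$. Put $\boldsymbol\eta_{h,\varepsilon}^{i,0}:=\mathbf m_{h,\varepsilon}^i$. Then, for every $\ell\ge0$, the linear problem of finding $\boldsymbol\eta_{h,\varepsilon}^{i,\ell+1}\in\mathbb V_h$ such that for all $\boldsymbol\phi_h\in\mathbb V_h$ $$\langle\boldsymbol\eta_{h,\varepsilon}^{i,\ell+1},\boldsymbol\phi_h\rangle_h+\alpha\langle\boldsymbol\eta_{h,\varepsilon}^{i,\ell+1}\times\mathbf m_{h,\varepsilon}^i,\boldsymbol\phi_h\rangle_h+\tfrac{\gamma k}{2}\langle\boldsymbol\eta_{h,\varepsilon}^{i,\ell+1}\times\mathcal H_{h,\lambda}\boldsymbol\eta_{h,\varepsilon}^{i,\ell},\boldsymbol\phi_h\rangle_h=\langle\mathbf m_{h,\varepsilon}^i,\boldsymbol\phi_h\rangle_h$$ admits a unique solution. Moreover, $$\|\boldsymbol\eta_{h,\varepsilon}^{i,\ell+1}\|_{\mathbb L^\infty}\le1 .$$ If the iteration is stopped at the first index $\ell_\ast\ge0$ satisfying $$\left\|I_h\left[\boldsymbol\eta_{h,\varepsilon}^{i,\ell_\ast+1}\times\mathcal H_{h,\lambda}\left(\boldsymbol\eta_{h,\varepsilon}^{i,\ell_\ast+1}-\boldsymbol\eta_{h,\varepsilon}^{i,\ell_\ast}\right)\right]\right\|_h\le\varepsilon_{i+1}$$ (with $\varepsilon_{i+1}>0$ a prescribed tolerance), then the update $\mathbf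 m_{h,\varepsilon}^{i+1}:=2\boldsymbol\eta_{h,\varepsilon}^{i,\ell_\ast+1}-\mathbf m_{h,\varepsilon}^i$ satisfies $\mathbf m_{h,\varepsilon}^{i+1}\in\mathcal M_h$.
   Context: Domain and spaces: $d\in\{1,2,3\}$; $\Omega\subset\mathbb R^d$ is an open bounded convex polytopal domain; $\mathbb L^p=L^p(\Omega;\mathbb R^3)$, $\mathbb H^1=H^1(\Omega;\mathbb R^3)$; $\langle\cdot,\cdot\rangle$ is the $L^2(\Omega)$ inner product of vector- or matrix-valued functions. The curl of an $\mathbb R^3$-valued function is the usual one for $d=3$, $\nabla\times\mathbf v=(\partial_2v_3,-\partial_1v_3,\partial_1v_2-\partial_2v_1)$ for $d=2$, and $\nabla\times\mathbf v=(0,-\partial_1v_3,\partial_1v_2)$ for $d=1$. $T,\alpha,\gamma,\kappa_{\mathrm e}>0$ and $\kappa_{\mathrm d}\in\mathbb R$ are constants; $N\in\mathbb N$, $k=T/N$. Finite elements: $\{\mathcal T_h\}_{h>0}$ is a shape-regular, quasi-uniform family of triangulations of $\Omega$ with maximal mesh size $h$ and vertex set $\mathcal N_h$; $\mathbb V_h$ is the space of continuous $\mathbb R^3$-valued functions that are affine on each $K\in\mathcal T_h$; $I_h:C^0(\overline\Omega;\mathbb R^3)\to\mathbb V_h$ is nodal interpolation; $\varphi_z$ ($z\in\mathcal N_h$) are the scalar nodal $P_1$ basis functions and $\beta_z=\int_\Omega\varphi_z\,dx$. The mass-lumped product of continuous fields is $\langle\mathbf u,\mathbf v\rangle_h=\sum_{z\in\mathcal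 N_h}\beta_z\,\mathbf u(z)\cdot\mathbf v(z)$, with $\|\mathbf v\|_h^2=\langle\mathbf v,\mathbf v\rangle_h$. $\mathcal M_h=\{\boldsymbol\phi_h\in\mathbb V_h:|\boldsymbol\phi_h(z)|=1\ \forall z\in\mathcal N_h\}$. Bilinear forms: $\mathfrak a(\mathbf v,\boldsymbol\chi)=\kappa_{\mathrm e}\langle\nabla\mathbf v,\nabla\boldsymbol\chi\rangle+\kappa_{\mathrm d}\langle\mathbf v,\nabla\times\boldsymbol\chi\rangle+\kappa_{\mathrm d}\langle\nabla\times\mathbf v,\boldsymbol\chi\rangle$; $\mathfrak a_{h,\lambda}(\mathbf v_h,\boldsymbol\chi_h)=\mathfrak a(\mathbf v_h,\boldsymbol\chi_h)+\lambda\langle\mathbf v_h,\boldsymbol\chi_h\rangle_h$, where $\lambda>0$ is a fixed constant (independent of $h$) chosen large enough that $\mathfrak a_{h,\lambda}(\mathbf v_h,\mathbf v_h)\ge c_\lambda\|\mathbf v_h\|_{\mathbb H^1}^2$ for all $\mathbf v_h\in\mathbb V_h$ with $c_\lambda>0$ independent of $h$. $\mathcal H_{h,\lambda}:\mathbb V_h\to\mathbb V_h$ is defined by $\langle\mathcal H_{h,\lambda}\mathbf v_h,\boldsymbol\chi_h\rangle_h=-\mathfrak a_{h,\lambda}(\mathbf v_h,\boldsymbol\chi_h)$ for all $\boldsymbol\chi_h\in\mathbb V_h$. *)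

(* Defs.v *)
From HB Require Import structures.
From mathcomp Require Import all_boot all_order all_algebra.
From mathcomp Require Import finmap.
From mathcomp Require Import all_classical all_reals all_analysis.

Set Implicit Arguments.
Unset Strict Implicit.
Unset Printing Implicit Defensive.

Import Order.TTheory GRing.Theory Num.Theory.
Import numFieldNormedType.Exports.

Local Open Scope classical_set_scope.
Local Open Scope ring_scope.

(* The sigma-algebra on row vectors generated by the coordinates, i.e. the
   Borel sets of R^n (the library does the same for n.-tuple T). *)
Definition rV_display : measure_display -> measure_display.
Proof. exact. Qed.

Section measurable_rV.
Context {R : realType} (n : nat).

Let coors : 'I_n -> 'rV[R]_n -> measurableTypeR R := fun i x => x 0 i.

Let rV_set0 : g_sigma_preimage coors set0.
Proof. exact: sigma_algebra0. Qed.

Let rV_setC A : g_sigma_preimage coors A -> g_sigma_preimage coors (~` A).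
Proof. exact: sigma_algebraC. Qed.

Let rV_bigcup (F : _^nat) : (forall i, g_sigma_preimage coors (F i)) ->
  g_sigma_preimage coors (\bigcup_i (F i)).
Proof. exact: sigma_algebra_bigcup. Qed.

HB.instance Definition _ := @isMeasurable.Build (rV_display default_measure_display)
  'rV[R]_n (g_sigma_preimage coors) rV_set0 rV_setC rV_bigcup.

End measurable_rV.

(* The image of a product measure under an isomorphism f of measurable spaces
   with inverse g, as a sigma-finite measure. *)
Section image_prod_measure.
Context d1 d2 d3 (T1 : measurableType d1) (T2 : measurableType d2)
  (T3 : measurableType d3) (R : realType).
Variables (m1 : {sigma_finite_measure set T1 -> \bar R})
  (m2 : {sigma_finite_measure set T2 -> \bar R}).
Variables (f : T1 * T2 -> T3) (g : T3 -> T1 * T2).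

Definition image_prod_measure of measurable_fun setT f & measurable_fun setT g
    & cancel f g : set T3 -> \bar R :=
  pushforward (m1 \x m2)%E f.

Hypotheses (mf : measurable_fun setT f) (mg : measurable_fun setT g)
  (fK : cancel f g).

Let mu := image_prod_measure mf mg fK.

Let mu0 : mu set0 = 0%E.
Proof.
by rewrite /mu /image_prod_measure /pushforward preimage_set0 measure0.
Qed.

Let mu_ge0 A : (0 <= mu A)%E.
Proof. exact: measure_ge0. Qed.

Let mu_sigma_additive : semi_sigma_additive mu.
Proof.
move=> F mF tF mUF.
rewrite /mu /image_prod_measure /pushforward preimage_bigcup.
apply: measure_semi_sigma_additive.
- by move=> n; rewrite -[X in measurable X]setTI; exact: mf.
- apply/trivIsetP => /= i j _ _ ij; rewrite -preimage_setI.
  by move/trivIsetP : tF => /(_ _ _ _ _ ij) ->//; rewrite preimage_set0.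
- by rewrite -preimage_bigcup -[X in measurable X]setTI; exact: mf.
Qed.

HB.instance Definition _ := isMeasure.Build _ _ _ mu mu0 mu_ge0 mu_sigma_additive.

Let mu_sigma_finite : sigma_finite setT mu.
Proof.
have /sigma_finiteP[F [TF ndF Foo]] := sigma_finiteT m1.
have /sigma_finiteP[G [TG ndG Goo]] := sigma_finiteT m2.
exists (fun n => g @^-1` (F n `*` G n)).
  rewrite -preimage_bigcup [X in _ @^-1` X](_ : _ = setT) ?preimage_setT//.
  rewrite -subTset => -[x y] _.
  have [n _ Fnx] : (\bigcup_i F i) x by rewrite -TF.
  have [k _ Gky] : (\bigcup_i G i) y by rewrite -TG.
  exists (maxn n k) => //; split.
  - by move: x Fnx; exact/subsetPset/ndF/leq_maxl.
  - by move: y Gky; exact/subsetPset/ndG/leq_maxr.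
move=> n; have [mFn Fnoo] := Foo n; have [mGn Gnoo] := Goo n; split.
  by rewrite -[X in measurable X]setTI; apply: mg => //; exact: measurableX.
rewrite /mu /image_prod_measure /pushforward -comp_preimage.
rewrite (_ : _ \o _ = id); last exact/funext/fK.
rewrite preimage_id /= product_measure1E// lte_mul_pinfty//.
by rewrite ge0_fin_numE.
Qed.

HB.instance Definition _ := @Measure_isSigmaFinite.Build _ _ _ mu
  mu_sigma_finite.

End image_prod_measure.

Section measurable_rV_lemmas.
Context {R : realType}.

Lemma measurable_rV_coord n (i : 'I_n) :
  measurable_fun [set: 'rV[R]_n] (fun x => x 0 i : measurableTypeR R).
Proof.
move=> _ Y mY; rewrite setTI; apply: sub_sigma_algebra => /=.
rewrite -bigcup_seq/=; exists i => /=; first by rewrite mem_index_enum.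
by exists Y => //; rewrite setTI.
Qed.

Lemma measurable_fun_rVP d (T : measurableType d) n (f : T -> 'rV[R]_n) :
  (forall i, measurable_fun [set: T] (fun x => f x 0 i : measurableTypeR R)) ->
  measurable_fun [set: T] f.
Proof.
move=> mf _ A.
have : g_sigma_preimage (fun i => (fun x : 'rV[R]_n => x 0 i : measurableTypeR R) \o f)
  `<=` @measurable _ T.
  apply: smallest_sub; first exact: sigma_algebra_measurable.
  case: n => [|n] in f mf A *; first by rewrite big_ord0.
  rewrite -bigcup_mkord_ord; apply: bigcup_sub => i Ii.
  by move=> B [C mC <-]; exact: mf.
rewrite g_sigma_preimage_comp => prefS mA.
by apply: prefS; exists A.
Qed.

Definition rV_cons n (p : measurableTypeR R * 'rV[R]_n) : 'rV[R]_n.+1 :=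
  \row_i if unlift 0 i is Some j then p.2 0 j else p.1.

Definition rV_uncons n (x : 'rV[R]_n.+1) : measurableTypeR R * 'rV[R]_n :=
  (x 0 0, \row_i x 0 (lift 0 i)).

Lemma rV_consK n : cancel (@rV_cons n) (@rV_uncons n).
Proof.
case=> a v; rewrite /rV_cons /rV_uncons; congr pair => /=.
  by rewrite mxE unlift_none.
by apply/rowP => i; rewrite !mxE liftK.
Qed.

Lemma measurable_rV_cons n : measurable_fun setT (@rV_cons n).
Proof.
apply: measurable_fun_rVP => i; case: (unliftP 0 i) => [j ->|->].
  rewrite (_ : (fun _ => _) =
      (fun v : 'rV[R]_n => v 0 j : measurableTypeR R) \o snd).
    by apply: measurableT_comp; [exact: measurable_rV_coord|exact: measurable_snd].
  by apply/funext => p; rewrite /rV_cons mxE liftK.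
rewrite (_ : (fun _ => _) = fst); first exact: measurable_fst.
by apply/funext => p; rewrite /rV_cons mxE unlift_none.
Qed.

Lemma measurable_rV_uncons n : measurable_fun setT (@rV_uncons n).
Proof.
apply/measurable_fun_pairP; split.
  exact: measurable_rV_coord.
apply: measurable_fun_rVP => i.
rewrite (_ : (fun _ => _) = fun x : 'rV[R]_n.+1 => x 0 (lift 0 i)).
  exact: measurable_rV_coord.
by apply/funext => x; rewrite /= mxE.
Qed.

(* Lebesgue measure on R^n, as the n-fold product of the one on R *)
Fixpoint lebesgue_rV n : {sigma_finite_measure set 'rV[R]_n -> \bar R} :=
  match n with
  | 0 => \d_(0 : 'rV[R]_0)
  | n'.+1 => image_prod_measure (@lebesgue_measure R) (lebesgue_rV n')
      (@measurable_rV_cons n') (@measurable_rV_uncons n') (@rV_consK n')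
  end.

End measurable_rV_lemmas.

Lemma lebesgue_rV_box (R : realType) n (A : 'I_n -> set (measurableTypeR R)) :
  (forall i, measurable (A i)) ->
  lebesgue_rV n [set x : 'rV[R]_n | forall i, A i (x 0 i)]
  = (\prod_(i < n) lebesgue_measure (A i))%E.
Proof.
elim: n A => [|n IHn] A mA.
  rewrite big_ord0 /= diracE mem_set//; by case.
rewrite big_ord_recl /= /image_prod_measure /pushforward.
pose B : set 'rV[R]_n := [set x | forall i, A (lift 0 i) (x 0 i)].
have mB : measurable B.
  rewrite (_ : B = \bigcap_(i in [set: 'I_n])
      ((fun x : 'rV[R]_n => x 0 i : measurableTypeR R) @^-1` A (lift 0 i))).
    apply: fin_bigcap_measurable => // i _.
    by rewrite -[X in measurable X]setTI; exact: measurable_rV_coord.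
  by apply/seteqP; split=> x /= Bx i; [move=> _|]; exact: Bx.
rewrite (_ : _ @^-1` _ = A 0 `*` B).
  rewrite product_measure1E//; congr (_ * _)%E.
  by rewrite -(IHn (fun i => A (lift 0 i))).
apply/seteqP; split=> -[a x] /=.
  move=> Ax; split; first by have := Ax 0; rewrite /rV_cons mxE unlift_none.
  by move=> i; have := Ax (lift 0 i); rewrite /rV_cons mxE liftK.
move=> [Aa Bx] i; rewrite /rV_cons mxE.
by case: (unliftP 0 i) => [j ->|->//]; exact: Bx.
Qed.

Section euclidean.
Context {R : realType}.

Definition dotv n (u v : 'rV[R]_n) : R := \sum_i u 0 i * v 0 i.

(* Euclidean norm; the library norm `|x| on row vectors is the max norm *)
Definition enorm n (u : 'rV[R]_n) : R := Num.sqrt (dotv u u).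

(* The indices are in 'I_3 = Z/3: (u x v)_i = u_(i+1) v_(i+2) - u_(i+2) v_(i+1). *)
Definition crossv (u v : 'rV[R]_3) : 'rV[R]_3 :=
  \row_i (u 0 (i + 1) * v 0 (i + 2) - u 0 (i + 2) * v 0 (i + 1)).

Variable d : nat.
Implicit Types (A Omega : set 'rV[R]_d) (K P : {fset 'rV[R]_d}).

Definition conv_hull P : set 'rV[R]_d :=
  [set x | exists w : 'rV[R]_d -> R,
    [/\ forall z, z \in P -> 0 <= w z,
        \sum_(z <- P) w z = 1 &
        \sum_(z <- P) w z *: z = x]].

Definition affinely_independent P : Prop :=
  forall w : 'rV[R]_d -> R,
    \sum_(z <- P) w z = 0 -> \sum_(z <- P) w z *: z = 0 ->
    forall z, z \in P -> w z = 0.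

Definition ediam A : R := sup [set enorm (p.1 - p.2) | p in A `*` A].

Definition inball_diam A : R :=
  sup [set 2 * r | r in [set r | 0 <= r /\
    exists x, [set y | enorm (y - x) <= r] `<=` A]].

(* nonempty, open, bounded, convex, and the closure is a polytope *)
Definition convex_polytopal_domain Omega : Prop :=
  [/\ Omega !=set0, open Omega, bounded_set Omega,
      convex_set (Omega : set (convex_lmodType 'rV[R]_d)) &
      exists P, closure Omega = conv_hull P].

(* A conforming triangulation; a cell is given by its finite set of vertices. *)
Record triangulation Omega := Triangulation {
  cells : {fset {fset 'rV[R]_d}};
  card_cell : forall K, K \in cells -> #|` K| = d.+1;
  cell_nondegenerate : forall K, K \in cells -> affinely_independent K;
  cells_cover : \bigcup_(K in [set` cells]) conv_hull K = closure Omega;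
  cells_conforming : forall K K', K \in cells -> K' \in cells ->
    conv_hull K `&` conv_hull K' = conv_hull (K `&` K')%fset }.

Definition nodes Omega (T : triangulation Omega) : {fset 'rV[R]_d} :=
  (\bigcup_(K <- cells T) K)%fset.

Definition mesh_size Omega (T : triangulation Omega) : R :=
  \big[Num.max/0]_(K <- cells T) ediam (conv_hull K).

(* A family of triangulations indexed by a set H of mesh sizes. *)
Section family.
Variables (Omega : set 'rV[R]_d) (H : set R) (T : R -> triangulation Omega).

Definition mesh_family : Prop :=
  forall h, H h -> 0 < h /\ mesh_size (T h) = h.

Definition shape_regular : Prop :=
  exists sigma : R, 0 < sigma /\
    forall h K, H h -> K \in cells (T h) ->
      ediam (conv_hull K) <= sigma * inball_diam (conv_hull K).

Definition quasi_uniform : Prop :=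
  exists c : R, 0 < c /\
    forall h K, H h -> K \in cells (T h) ->
      c * mesh_size (T h) <= ediam (conv_hull K).
End family.

End euclidean.

Section finite_elements.
Context {R : realType} {d : nat} {Omega : set 'rV[R]_d}.
Variable T : triangulation Omega.

Local Notation mu := (lebesgue_rV d).
Local Notation field := ('rV[R]_d -> 'rV[R]_3).
Implicit Types u v w chi phi : field.

(* Continuous on the closure of Omega and affine on each cell. A function on
   the closure of Omega is represented by its extension by 0 to R^d, so that
   equality of functions is equality on the closure of Omega. *)
Definition P1 (E : normedModType R) : set ('rV[R]_d -> E) :=
  [set f | [/\ {within closure Omega, continuous f},
     forall K, K \in cells T -> exists (L : {linear 'rV[R]_d -> E}) (b : E),
       forall x, conv_hull K x -> f x = L x + b &
     forall x, ~ closure Omega x -> f x = 0]].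

Definition Vh : set field := @P1 'rV[R]_3.

(* nodal basis: the P1 function with value 1 at z and 0 at the other nodes *)
Definition nodal_basis (z : 'rV[R]_d) : 'rV[R]_d -> R :=
  xget (fun=> 0) [set f | @P1 R^o f /\
    forall z', z' \in nodes T -> f z' = (z' == z)%:R].

Definition beta (z : 'rV[R]_d) : R := \int[mu]_(x in Omega) nodal_basis z x.

Definition nodal_interp v : field :=
  fun x => \sum_(z <- nodes T) nodal_basis z x *: v z.

Definition lumped u v : R := \sum_(z <- nodes T) beta z * dotv (u z) (v z).

Definition lumped_norm v : R := Num.sqrt (lumped v v).

Definition Mh : set field :=
  [set phi | Vh phi /\ forall z, z \in nodes T -> enorm (phi z) = 1].

(* j-th partial derivative, j counted from 0; it is 0 when d <= j, i.e. fields
   are constant along the directions missing from R^d. *)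
Definition pderiv (j : nat) (f : 'rV[R]_d -> R) (x : 'rV[R]_d) : R :=
  if insub j is Some i then 'D_(delta_mx 0 (i : 'I_d)) (f : _ -> R^o) x else 0.

(* (curl v)_i = d_(i+1) v_(i+2) - d_(i+2) v_(i+1), indices in Z/3. With the
   convention on pderiv this is (d_2 v_3, - d_1 v_3, d_1 v_2 - d_2 v_1) if
   d = 2 and (0, - d_1 v_3, d_1 v_2) if d = 1 (1-based indices). *)
Definition curl v : field := fun x =>
  \row_i (pderiv (i + 1 : 'I_3)%R (fun y => v y 0 (i + 2)) x
          - pderiv (i + 2 : 'I_3)%R (fun y => v y 0 (i + 1)) x).

Definition l2 u v : R := \int[mu]_(x in Omega) dotv (u x) (v x).

Definition l2_grad u v : R :=
  \int[mu]_(x in Omega) \sum_(i < 3) \sum_(j < d)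
    pderiv j (fun y => u y 0 i) x * pderiv j (fun y => v y 0 i) x.

Definition h1_norm v : R := Num.sqrt (l2 v v + l2_grad v v).

Definition linfty_norm v : \bar R :=
  'N[mu]_+oo[(EFin \o (fun x => enorm (v x))) \_ Omega]%E.

Variables kappa_e kappa_d lambda : R.

Definition form_a v chi : R :=
  kappa_e * l2_grad v chi + kappa_d * l2 v (curl chi)
  + kappa_d * l2 (curl v) chi.

Definition form_a_lambda v chi : R := form_a v chi + lambda * lumped v chi.

(* the element of Vh representing - form_a_lambda v in the lumped product *)
Definition Hh v : field :=
  xget (fun=> 0) [set w | Vh w /\
    forall chi, Vh chi -> lumped w chi = - form_a_lambda v chi].

End finite_elements.

Arguments l2 {R d} Omega u v.
Arguments l2_grad {R d} Omega u v.
Arguments h1_norm {R d} Omega v.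
Arguments linfty_norm {R d} Omega v.

(* Main.v *)
From HB Require Import structures.
Require Import Defs.
From mathcomp Require Import all_boot all_order all_algebra.
From mathcomp Require Import finmap ring lra.
From mathcomp Require Import all_classical all_reals all_analysis.
From mathcomp Require Import ess_sup_inf.

(** The lumped product [lumped T u v] sees the fields [u] and [v] only through
    their values at the nodes, each node [z] carrying the weight [beta T z].
    Testing with the fields [hat T z x *: delta_mx 0 j] therefore decouples the
    linear problem into one equation in R^3 per node,
      [eta z + crossv (eta z) b = m z], with [b = alpha *: m z + c *: w z],
    where [w] is the image of the previous iterate under the discrete effective
    field operator.

    The nodal equation is solved by elementary vector algebra. The operator
    [u |-> u + crossv u b] is the identity plus a skew-symmetric map, so taking
    the dot product of the equation with [u] gives [|u|^2 = v . u] for the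
    right-hand side [v]. Hence the kernel is trivial; [|v| = 1] implies
    [|u| <= 1]; and [|2 u - v|^2 = 4 (|u|^2 - u . v) + |v|^2 = |v|^2], so that
    every iterate, and thus the one at which the iteration stops, gives an update
    with values on the unit sphere at the nodes. The solution is the explicit vector
    [cross_resolvent b v].

    Going from nodal values to fields and back requires two facts about the
    triangulation. First, the nodal basis exists ([nodal_basis_hat]): the hat
    functions are the barycentric coordinates on the cells, which agree on
    the intersection of two cells because the triangulation is conforming, and
    a P1 function is determined by its nodal values ([P1_eq]). Second, the
    weights are positive ([beta_gt0]): a hat function is nonnegative, and it is
    bounded below by a positive constant on some cube contained in the domain.
    Finally, on each cell a P1 field is a convex combination of its nodal
    values, so the nodal bound by 1 holds on the whole domain
    ([Vh_dotv_le1]). *)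

Set Implicit Arguments.
Unset Strict Implicit.
Unset Printing Implicit Defensive.

Import Order.TTheory GRing.Theory Num.Theory.
Import numFieldNormedType.Exports.

Local Open Scope classical_set_scope.
Local Open Scope ring_scope.

(** * Dot and cross products *)

Section vectors.
Context {R : realType}.

Section dot.
Context {n : nat}.
Implicit Types u v w : 'rV[R]_n.

Lemma dotvC u v : dotv u v = dotv v u.
Proof. by apply: eq_bigr => i _; rewrite mulrC. Qed.

Lemma dotvDl u v w : dotv (u + v) w = dotv u w + dotv v w.
Proof. by rewrite /dotv -big_split; apply: eq_bigr => i _; rewrite mxE mulrDl. Qed.

Lemma dotvZl (a : R) u v : dotv (a *: u) v = a * dotv u v.
Proof. by rewrite /dotv mulr_sumr; apply: eq_bigr => i _; rewrite mxE mulrA. Qed.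

Lemma dotvBl u v w : dotv (u - v) w = dotv u w - dotv v w.
Proof. by rewrite dotvDl -scaleN1r dotvZl mulN1r. Qed.

Lemma dotv_suml (I : Type) (s : seq I) (F : I -> 'rV[R]_n) v :
  dotv (\sum_(i <- s) F i) v = \sum_(i <- s) dotv (F i) v.
Proof.
elim/big_rec2: _ => [|i x y _ <-]; last by rewrite dotvDl.
by rewrite /dotv big1// => i _; rewrite mxE mul0r.
Qed.

Lemma dotv_ge0 u : 0 <= dotv u u.
Proof. by apply: sumr_ge0 => i _; rewrite -expr2 sqr_ge0. Qed.

Lemma dotv_eq0 u : dotv u u = 0 -> u = 0.
Proof.
move=> /eqP; rewrite psumr_eq0; last by move=> i _; rewrite -expr2 sqr_ge0.
move=> /allP u0; apply/rowP => i; rewrite mxE.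
by have := u0 i (mem_index_enum i); rewrite mulf_eq0 orbb => /eqP.
Qed.

Lemma dotv_delta u j : dotv u (delta_mx 0 j) = u 0 j.
Proof.
rewrite /dotv (bigD1 j)//= big1 ?addr0 ?mxE ?eqxx ?mulr1//.
by move=> i ij; rewrite mxE eqxx (negbTE ij) mulr0.
Qed.

(** Used in place of the Cauchy-Schwarz inequality: an estimate
    [q <= dotv u v] with [q = dotv v v] and [dotv u u <= 1] already forces
    [q <= 1]. *)
Lemma dotv_le_half u v : dotv u v <= (dotv u u + dotv v v) / 2.
Proof.
by have := dotv_ge0 (u - v); rewrite dotvBl !(dotvC _ (u - v)) !dotvBl (dotvC v u); lra.
Qed.

Lemma enorm_le1 u : (enorm u <= 1) = (dotv u u <= 1).
Proof. by rewrite /enorm -[X in _ <= X]sqrtr1 ler_psqrt// ?nnegrE ?dotv_ge0. Qed.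

Lemma enorm_eq1 u : enorm u = 1 <-> dotv u u = 1.
Proof.
split=> [u1|u1]; last by rewrite /enorm u1 sqrtr1.
by rewrite -(sqr_sqrtr (dotv_ge0 u)) -/(enorm u) u1 expr1n.
Qed.

End dot.

Implicit Types a b u v w : 'rV[R]_3.

Lemma dotv3 u v : dotv u v = u 0 0 * v 0 0 + u 0 1 * v 0 1 + u 0 2 * v 0 2.
Proof.
rewrite /dotv !big_ord_recl big_ord0 addr0 addrA.
by congr (_ * _ + _ * _ + _ * _); congr (_ _ _); apply/val_inj.
Qed.

Lemma crossv0 u v : crossv u v 0 0 = u 0 1 * v 0 2 - u 0 2 * v 0 1.
Proof. by rewrite mxE !add0r. Qed.

Lemma crossv1 u v : crossv u v 0 1 = u 0 2 * v 0 0 - u 0 0 * v 0 2.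
Proof.
have e2 : 1 + 1 = 2 :> 'I_3 by apply/val_inj.
have e0 : 1 + 2 = 0 :> 'I_3 by apply/val_inj.
by rewrite mxE e2 e0.
Qed.

Lemma crossv2 u v : crossv u v 0 2 = u 0 0 * v 0 1 - u 0 1 * v 0 0.
Proof.
have e0 : 2 + 1 = 0 :> 'I_3 by apply/val_inj.
have e1 : 2 + 2 = 1 :> 'I_3 by apply/val_inj.
by rewrite mxE e0 e1.
Qed.

Definition crossvE := (crossv0, crossv1, crossv2).

Lemma rowP3 u v : u 0 0 = v 0 0 -> u 0 1 = v 0 1 -> u 0 2 = v 0 2 -> u = v.
Proof.
move=> e0 e1 e2; apply/rowP => -[[|[|[|//]]] p].
- by rewrite (_ : Ordinal p = 0)//; exact/val_inj.
- by rewrite (_ : Ordinal p = 1)//; exact/val_inj.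
- by rewrite (_ : Ordinal p = 2)//; exact/val_inj.
Qed.

Lemma crossvDr u a b : crossv u (a + b) = crossv u a + crossv u b.
Proof. by apply/rowP => i; rewrite !mxE; ring. Qed.

Lemma crossvZr u c b : crossv u (c *: b) = c *: crossv u b.
Proof. by apply/rowP => i; rewrite !mxE; ring. Qed.

Lemma crossvBl u v b : crossv (u - v) b = crossv u b - crossv v b.
Proof. by apply/rowP => i; rewrite !mxE; ring. Qed.

Lemma dotv_cross u b : dotv (crossv u b) u = 0.
Proof. by rewrite dotv3 !crossvE; ring. Qed.

(** The value at [v] of the inverse of [u |-> u + crossv u b]. The map
    [A : u |-> crossv u b] satisfies [A^3 = - |b|^2 A], so the inverse of [1 + A]
    is [(1 + |b|^2 - A + A^2) / (1 + |b|^2)], where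
    [A^2 v = dotv b v *: b - |b|^2 v]. *)
Definition cross_resolvent b v : 'rV[R]_3 :=
  (1 + dotv b b)^-1 *: (v + dotv b v *: b - crossv v b).

Lemma cross_resolventP b v : cross_resolvent b v + crossv (cross_resolvent b v) b = v.
Proof.
have : 1 + dotv b b != 0 by rewrite gt_eqF// ltr_pwDl ?dotv_ge0.
by rewrite dotv3 => H; apply: rowP3; rewrite !(crossvE, mxE) !dotv3 ?crossvE; field.
Qed.

(** The cross product is orthogonal to [u]; all properties of solutions of
    the nodal equation are consequences of this identity. *)
Lemma dotv_cross_resolvent b v u : u + crossv u b = v -> dotv u u = dotv v u.
Proof. by move=> <-; rewrite dotvDl dotv_cross addr0. Qed.

Lemma cross_resolvent_unique b v u u' :
  u + crossv u b = v -> u' + crossv u' b = v -> u = u'.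
Proof.
move=> uv u'v; apply/eqP; rewrite -subr_eq0; apply/eqP/dotv_eq0.
rewrite (@dotv_cross_resolvent b 0); first by rewrite -(scale0r 0) dotvZl mul0r.
by rewrite crossvBl addrACA uv -opprD u'v subrr.
Qed.

Lemma cross_resolvent_le1 b v u : u + crossv u b = v -> dotv v v = 1 -> dotv u u <= 1.
Proof.
by move=> /dotv_cross_resolvent uv v1; have := dotv_le_half v u; rewrite -uv v1; lra.
Qed.

(** The vector [2 *: u - v] is the image of [v] under the Cayley transform of a
    skew-symmetric map, which is an isometry. *)
Lemma cross_resolvent_reflect b v u : u + crossv u b = v ->
  dotv (2 *: u - v) (2 *: u - v) = dotv v v.
Proof.
move=> /dotv_cross_resolvent uv.
rewrite dotvBl dotvZl !(dotvC _ (2 *: u - v)) !dotvBl !dotvZl (dotvC u v) -uv; ring.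
Qed.

End vectors.

(** * Affine maps and barycentric representations *)

Section affine.
Context {R : realType} {d : nat}.

Definition affine {E : lmodType R} (f : 'rV[R]_d -> E) : Prop :=
  exists (L : {linear 'rV[R]_d -> E}) (b : E), forall x, f x = L x + b.

(** Every linear map on row vectors has this form, which makes sums, multiples
    and continuity of linear maps accessible by computation. *)
Definition lincomb {E : lmodType R} (c : 'I_d -> E) (x : 'rV[R]_d) : E :=
  \sum_j x 0 j *: c j.

Lemma lincomb_is_linear {E : lmodType R} (c : 'I_d -> E) : linear (lincomb c).
Proof.
move=> a x y; rewrite /lincomb scaler_sumr -big_split; apply: eq_bigr => j _ /=.
by rewrite !mxE scalerDl scalerA.
Qed.

HB.instance Definition _ {E : lmodType R} (c : 'I_d -> E) :=
  GRing.isLinear.Build R 'rV[R]_d E *:%R (lincomb c) (lincomb_is_linear c).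

Lemma affine_lincomb {E : lmodType R} (c : 'I_d -> E) b (f : 'rV[R]_d -> E) :
  (forall x, f x = lincomb c x + b) -> affine f.
Proof. by move=> H; exists (lincomb c), b. Qed.

Lemma affineP {E : lmodType R} (f : 'rV[R]_d -> E) :
  affine f -> exists c b, forall x, f x = lincomb c x + b.
Proof.
move=> [L [b fE]]; exists (fun j => L (delta_mx 0 j)), b => x.
rewrite fE {1}(row_sum_delta x) linear_sum; congr (_ + _).
by apply: eq_bigr => j _; rewrite linearZ.
Qed.

Lemma affine_cst {E : lmodType R} (b : E) : affine (fun=> b).
Proof.
by exists \0, b => x; rewrite add0r.
Qed.

Lemma affineD {E : lmodType R} (f g : 'rV[R]_d -> E) :
  affine f -> affine g -> affine (fun x => f x + g x).
Proof.
move=> /affineP[c [b fE]] /affineP[c' [b' gE]].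
apply: (@affine_lincomb _ (fun j => c j + c' j) (b + b')) => x.
rewrite fE gE addrACA; congr (_ + _); rewrite -big_split.
by apply: eq_bigr => j _; rewrite scalerDr.
Qed.

Lemma affineZr {E : lmodType R} (f : 'rV[R]_d -> R^o) (a : E) :
  affine f -> affine (fun x => f x *: a).
Proof.
move=> /affineP[c [b fE]].
apply: (@affine_lincomb _ (fun j => (c j : R) *: a) ((b : R) *: a)) => x.
rewrite fE scalerDl scaler_suml; congr (_ + _).
by apply: eq_bigr => j _; rewrite scalerA.
Qed.

Lemma affineZl {E : lmodType R} (a : R) (f : 'rV[R]_d -> E) :
  affine f -> affine (fun x => a *: f x).
Proof.
move=> /affineP[c [b fE]].
apply: (@affine_lincomb _ (fun j => a *: c j) (a *: b)) => x.
rewrite fE scalerDr scaler_sumr; congr (_ + _).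
by apply: eq_bigr => j _; rewrite !scalerA mulrC.
Qed.

Lemma lincomb_continuous {E : normedModType R} (c : 'I_d -> E) :
  continuous (lincomb c).
Proof.
rewrite /lincomb; elim: (index_enum 'I_d) => [|j s IHs].
  rewrite (_ : (fun _ => _) = cst 0); first exact: cst_continuous.
  by apply/funext => y; rewrite big_nil.
rewrite (_ : (fun _ => _) =
    (fun y : 'rV[R]_d => y 0 j *: c j) \+ (fun y => \sum_(i <- s) y 0 i *: c i)).
  by move=> x; apply: cvgD (IHs x); apply: cvgZr_tmp; exact: coord_continuous.
by apply/funext => y; rewrite big_cons.
Qed.

Lemma affine_continuous {E : normedModType R} (f : 'rV[R]_d -> E) :
  affine f -> continuous f.
Proof.
move=> /affineP[c [b fE]] x.
rewrite (_ : f = fun x => lincomb c x + b); last exact/funext.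
have := @cvgD _ _ _ (nbhs x) _ (lincomb c) (cst b) _ _
  (@lincomb_continuous _ c x) (cvg_cst b).
exact.
Qed.

(** The weights are required to vanish off [K], so that they are unique as
    functions when [K] is affinely independent, and so that the same function
    represents [x] over any larger set of points. *)
Definition barycentric (K : {fset 'rV[R]_d}) (w : 'rV[R]_d -> R) x : Prop :=
  [/\ forall z, z \notin K -> w z = 0,
      \sum_(z <- K) w z = 1 & \sum_(z <- K) w z *: z = x].

Lemma barycentric_unique K w w' x : affinely_independent K ->
  barycentric K w x -> barycentric K w' x -> w = w'.
Proof.
move=> indK [w0 w1 wx] [w'0 w'1 w'x]; apply/funext => z.
have [zK|zK] := boolP (z \in K); last by rewrite w0// w'0.
apply/eqP; rewrite -subr_eq0; apply/eqP.
apply: (indK (fun z => w z - w' z)) => //; first by rewrite sumrB w1 w'1 subrr.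
by under eq_bigr do rewrite scalerBl; rewrite sumrB wx w'x subrr.
Qed.

Lemma barycentric_sub (K K' : {fset 'rV[R]_d}) w x : (K `<=` K')%fset ->
  barycentric K w x -> barycentric K' w x.
Proof.
move=> KK' [w0 w1 wx]; split=> [z zK'||].
- by rewrite w0//; apply: contra zK'; exact: (fsubsetP KK').
- by rewrite -(big_fset_incl _ KK') ?w1// => z _; exact: w0.
- by rewrite -(big_fset_incl _ KK') ?wx// => z _ /w0 ->; rewrite scale0r.
Qed.

Lemma conv_hullP K x :
  conv_hull K x <-> exists2 w, barycentric K w x & forall z, 0 <= w z.
Proof.
split=> [[w [wge0 w1 wx]]|[w [w0 w1 wx] wge0]]; last by exists w; split.
exists (fun z => if z \in K then w z else 0); last first.
  by move=> z; case: ifPn => // /wge0.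
split=> [z /negbTE -> //||].
  by rewrite -w1 big_seq [RHS]big_seq; apply: eq_bigr => z ->.
by rewrite -wx big_seq [RHS]big_seq; apply: eq_bigr => z ->.
Qed.

Lemma barycentric_vertex (K : {fset 'rV[R]_d}) z : z \in K ->
  barycentric K (fun y => (y == z)%:R) z.
Proof.
move=> zK; split=> [y yK||].
- by case: eqP => // yz; rewrite yz zK in yK.
- rewrite (big_fsetD1 z zK) eqxx /= big_seq big1 ?addr0// => y.
  by rewrite !inE => /andP[/negbTE ->].
- rewrite (big_fsetD1 z zK) eqxx scale1r /= big_seq big1 ?addr0// => y.
  by rewrite !inE => /andP[/negbTE ->]; rewrite scale0r.
Qed.

Lemma conv_hull_vertex (K : {fset 'rV[R]_d}) z : z \in K -> conv_hull K z.
Proof.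
move=> zK; apply/conv_hullP; exists (fun y => (y == z)%:R) => //.
exact: barycentric_vertex.
Qed.

Lemma affine_barycentric {E : lmodType R} (f : 'rV[R]_d -> E) K w x :
  affine f -> barycentric K w x -> f x = \sum_(z <- K) w z *: f z.
Proof.
move=> [L [b fE]] [_ w1 wx]; rewrite fE -wx linear_sum.
rewrite -[b]scale1r -w1 scaler_suml -big_split; apply: eq_bigr => z _.
by rewrite /= linearZ fE scalerDr.
Qed.

End affine.

(** * Barycentric coordinates of a simplex *)

Section simplex.
Context {R : realType} {d : nat}.
Variable K : {fset 'rV[R]_d}.
Hypotheses (cardK : #|` K| = d.+1) (indK : affinely_independent K).

Lemma affine_row_mx (N : 'M[R]_(1 + d, d.+1)) k :
  affine (fun x : 'rV[R]_d => (row_mx 1%:M x *m N) 0 k : R^o).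
Proof.
apply: (@affine_lincomb _ _ _ (fun j => N (rshift 1 j) k : R^o) (N (lshift d 0) k)) => x.
rewrite mxE big_split_ord big_ord1 /= row_mxEl mxE eqxx mul1r addrC.
by congr (_ + _); apply: eq_bigr => j _; rewrite row_mxEr.
Qed.

(** The rows [(1, z)], for [z] a vertex, form a square matrix whose left kernel
    consists of the affine dependences of the vertices, hence an invertible one.
    The coordinates of [x] are the entries of the row vector
    [(1, x)] times the inverse, which are affine functions of [x]. *)
Lemma simplex_coordinates : exists l : 'rV[R]_d -> 'rV[R]_d -> R^o,
  (forall z, affine (l z)) /\ forall x, barycentric K (l^~ x) x.
Proof.
pose s := enum_fset K; have sz : size s = d.+1 by rewrite -cardK.
have us : uniq s := fset_uniq K.
have sumK (V : nmodType) (F : 'rV[R]_d -> V) :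
    \sum_(z <- K) F z = \sum_(i < d.+1) F (nth 0 s i).
  by rewrite (big_nth 0) -/s sz big_mkord.
have idx (i : 'I_d.+1) : inord (index (nth 0 s i) s) = i.
  by rewrite index_uniq ?sz// inord_val.
have memK (i : 'I_d.+1) : nth 0 s i \in K by rewrite mem_nth ?sz.
pose M : 'M[R]_(d.+1, 1 + d) :=
  \matrix_(i, j) row_mx (1%:M : 'M[R]_1) (nth 0 s i) 0 j.
have M1 i : M i (lshift d 0) = 1 by rewrite mxE row_mxEl mxE.
have Mx i j : M i (rshift 1 j) = nth 0 s i 0 j by rewrite mxE row_mxEr.
(* A row vector in the left kernel is an affine dependence. *)
have Munit : (M : 'M[R]_d.+1) \in unitmx.
  rewrite -row_free_unit; apply: inj_row_free => v vM.
  have vM0 j : \sum_i v 0 i * M i j = 0.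
    by have /rowP/(_ j) := vM; rewrite !mxE.
  apply/rowP => i; rewrite mxE -[i]idx.
  apply: (@indK (fun z => v 0 (inord (index z s)))) (memK i).
    rewrite sumK -[RHS](vM0 (lshift d 0)); apply: eq_bigr => k _.
    by rewrite idx M1 mulr1.
  apply/rowP => j; rewrite sumK summxE mxE -[RHS](vM0 (rshift 1 j)).
  by apply: eq_bigr => k _; rewrite mxE idx Mx.
pose l (x : 'rV[R]_d) : 'rV[R]_d.+1 := row_mx 1%:M x *m invmx (M : 'M[R]_d.+1).
have lM x j : \sum_i l x 0 i * M i j = row_mx (1%:M : 'M[R]_1) x 0 j.
  by rewrite -[in RHS](mulmxKV Munit (row_mx 1%:M x)) [RHS]mxE.
exists (fun z x => if z \in K then l x 0 (inord (index z s)) else 0).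
split=> [z|x].
  by case: (z \in K); [exact: affine_row_mx|exact: affine_cst].
split=> [z /negbTE -> //||].
  rewrite sumK -(_ : row_mx (1%:M : 'M[R]_1) x 0 (lshift d 0) = 1); last first.
    by rewrite row_mxEl mxE.
  by rewrite -lM; apply: eq_bigr => i _; rewrite memK idx M1 mulr1.
apply/rowP => j; rewrite sumK summxE -[RHS](row_mxEr (1%:M : 'M[R]_1)) -lM.
by apply: eq_bigr => i _; rewrite memK mxE idx Mx.
Qed.

Definition bcoord x : 'rV[R]_d -> R :=
  xget (fun=> 0) [set w | barycentric K w x].

Lemma bcoordP x : barycentric K (bcoord x) x.
Proof.
have [l [_ lP]] := simplex_coordinates.
apply: (@xgetPex _ (fun=> 0) [set w | barycentric K w x]).
by exists (l^~ x); exact: lP.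
Qed.

Lemma bcoordE w x : barycentric K w x -> bcoord x = w.
Proof. exact: barycentric_unique (bcoordP x). Qed.

Lemma bcoord_affine z : affine (fun x => bcoord x z : R^o).
Proof.
have [l [la lP]] := simplex_coordinates.
rewrite (_ : (fun _ => _) = l z)//.
by apply/funext => x; rewrite (bcoordE (lP x)).
Qed.

(** This describes the simplex by finitely many affine inequalities, from which
    it follows that it is closed and has interior points. *)
Lemma conv_hull_bcoord x : conv_hull K x <-> forall z, 0 <= bcoord x z.
Proof.
rewrite conv_hullP; split=> [[w /bcoordE -> //]|x0].
by exists (bcoord x) => //; exact: bcoordP.
Qed.

Lemma conv_hull_closed : closed (conv_hull K).
Proof.
rewrite (_ : conv_hull K =
    \bigcap_(z in setT) ((fun x => bcoord x z : R^o) @^-1` [set t | 0 <= t])).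
  apply: closed_bigI => z _; apply: preimage_closed; last exact: closed_ge.
  by move=> x _; apply: affine_continuous; exact: bcoord_affine.
apply/seteqP; split=> [x /conv_hull_bcoord x0 z _|x x0]; first exact: x0.
by apply/conv_hull_bcoord => z; exact: x0.
Qed.

(** The centroid has all its coordinates equal to [1 / (d + 1)]. *)
Lemma bcoord_interior : exists2 x : 'rV[R]_d, conv_hull K x &
  forall z, z \in K -> 0 < bcoord x z.
Proof.
pose w (z : 'rV[R]_d) : R := if z \in K then d.+1%:R^-1 else 0.
have wP : barycentric K w (\sum_(z <- K) w z *: z).
  split=> [z /negbTE|//|//]; first by rewrite /w => ->.
  rewrite big_seq /w; under eq_bigr => z zK do rewrite zK.
  rewrite -big_seq big_const_seq iter_addr_0 count_predT cardK.
  by rewrite -(mulr_natr d.+1%:R^-1) mulVf.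
exists (\sum_(z <- K) w z *: z).
  by apply/conv_hullP; exists w => // z; rewrite /w; case: ifP.
by move=> z zK; rewrite (bcoordE wP) /w zK invr_gt0.
Qed.

End simplex.

(** * Continuous piecewise affine functions *)

Section P1.
Context {R : realType} {d : nat} {Omega : set 'rV[R]_d}.
Variable T : triangulation Omega.
Implicit Types (K : {fset 'rV[R]_d}) (E : normedModType R).

Lemma cell_bcoordP K x : K \in cells T -> barycentric K (bcoord K x) x.
Proof.
by move=> KT; apply: bcoordP; [exact: card_cell KT|exact: cell_nondegenerate KT].
Qed.

Lemma cell_bcoordE K w x : K \in cells T -> barycentric K w x -> bcoord K x = w.
Proof.
by move=> KT; apply: bcoordE; [exact: card_cell KT|exact: cell_nondegenerate KT].
Qed.

Lemma cell_bcoord_ge0 K x z : K \in cells T -> conv_hull K x ->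
  0 <= bcoord K x z.
Proof.
move=> KT /conv_hull_bcoord; apply;
  [exact: card_cell KT|exact: cell_nondegenerate KT].
Qed.

Lemma closure_cell x :
  closure Omega x <-> exists2 K, K \in cells T & conv_hull K x.
Proof. by rewrite -(cells_cover T). Qed.

Lemma nodeP z : z \in nodes T <-> exists2 K, K \in cells T & z \in K.
Proof.
split=> [/bigfcupP[K /andP[KT _] zK]|[K KT zK]]; first by exists K.
by apply/bigfcupP; exists K; rewrite ?KT.
Qed.

Lemma P1D E (f g : 'rV[R]_d -> E) : P1 T f -> P1 T g ->
  P1 T (fun x => f x + g x).
Proof.
move=> [cf af f0] [cg ag g0]; split; first exact: within_continuousD.
- move=> K KT; have [L [b fE]] := af K KT; have [L' [b' gE]] := ag K KT.
  have [L2 [b2 H]] : affine (fun x => (L x + b) + (L' x + b')).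
    by apply: affineD; [exists L, b|exists L', b'].
  by exists L2, b2 => x Kx; rewrite fE// gE// H.
- by move=> x xO; rewrite f0// g0// addr0.
Qed.

Lemma P1Zr E (f : 'rV[R]_d -> R^o) (a : E) : P1 T f ->
  P1 T (fun x => f x *: a).
Proof.
move=> [cf af f0]; split.
- by move=> x; apply: cvgZr_tmp; exact: cf.
- move=> K KT; have [L [b fE]] := af K KT.
  have [L2 [b2 H]] : affine (fun x => (L x + b : R^o) *: a).
    by apply: affineZr; exists L, b.
  by exists L2, b2 => x Kx; rewrite fE.
- by move=> x xO; rewrite f0// scale0r.
Qed.

Lemma P1Zl E (a : R) (f : 'rV[R]_d -> E) : P1 T f -> P1 T (fun x => a *: f x).
Proof.
move=> [cf af f0]; split.
- by move=> x; apply: cvgZl_tmp; exact: cf.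
- move=> K KT; have [L [b fE]] := af K KT.
  have [L2 [b2 H]] : affine (fun x => a *: (L x + b)).
    by apply: affineZl; exists L, b.
  by exists L2, b2 => x Kx; rewrite fE.
- by move=> x xO; rewrite f0// scaler0.
Qed.

Lemma P1_sum E (I : Type) (s : seq I) (F : I -> 'rV[R]_d -> E) :
  (forall i, P1 T (F i)) -> P1 T (fun x => \sum_(i <- s) F i x).
Proof.
move=> P1F; elim: s => [|i s IHs].
  under eq_fun do rewrite big_nil.
  split=> [|K _|//]; first by apply: continuous_subspaceT; exact: cst_continuous.
  by exists \0, 0 => x _; rewrite addr0.
by under eq_fun do rewrite big_cons; exact: P1D.
Qed.

(** Both the uniqueness of P1 functions with given nodal values and the
    extension of nodal bounds to the whole domain rest on this formula. *)
Lemma P1_eval E (f : 'rV[R]_d -> E) K x : P1 T f -> K \in cells T ->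
  conv_hull K x -> f x = \sum_(z <- K) bcoord K x z *: f z.
Proof.
move=> [_ af _] KT Kx; have [L [b fE]] := af K KT.
have aff : affine (fun y => L y + b) by exists L, b.
rewrite fE// (affine_barycentric aff (cell_bcoordP x KT)).
rewrite big_seq [RHS]big_seq; apply: eq_bigr => z zK; rewrite fE//.
exact: conv_hull_vertex.
Qed.

Lemma P1_eq E (f g : 'rV[R]_d -> E) : P1 T f -> P1 T g ->
  (forall z, z \in nodes T -> f z = g z) -> f = g.
Proof.
move=> Pf Pg fg; apply/funext => x.
have [/closure_cell[K KT Kx]|xO] := pselect (closure Omega x); last first.
  by case: Pf Pg => _ _ f0 [_ _ g0]; rewrite f0// g0.
rewrite (P1_eval Pf KT Kx) (P1_eval Pg KT Kx).
rewrite big_seq [RHS]big_seq; apply: eq_bigr => z zK; rewrite fg//.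
by apply/nodeP; exists K.
Qed.

(** The cell is chosen arbitrarily among those containing [x]; by conformity
    the value does not depend on the choice ([hat_cell]). When there is none,
    the default cell is empty, no weights represent [x] over it, and the value
    is the default weight 0, as required of extensions by zero. *)
Definition hat (z x : 'rV[R]_d) : R :=
  bcoord (xget fset0 [set K | K \in cells T /\ conv_hull K x]) x z.

(** If [x] lies in two cells, it lies in the convex hull of their common vertices.
    Weights representing [x] over the common vertices represent it over both
    cells, so by uniqueness they are the coordinates of [x] in each of them. *)
Lemma hat_cell z K x : K \in cells T -> conv_hull K x -> hat z x = bcoord K x z.
Proof.
move=> KT Kx; rewrite /hat; set K' := xget _ _.
have [K'T K'x] : [set K | K \in cells T /\ conv_hull K x] K'.
  by apply: xgetPex; exists K.
have : conv_hull (K `&` K')%fset x by rewrite -(cells_conforming KT K'T).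
move=> /conv_hullP[w wP _].
rewrite (cell_bcoordE KT (barycentric_sub (fsubsetIl K K') wP)).
by rewrite (cell_bcoordE K'T (barycentric_sub (fsubsetIr K K') wP)).
Qed.

Lemma hat_out z x : ~ closure Omega x -> hat z x = 0.
Proof.
move=> xO; rewrite /hat (xgetPN _ (P := [set K | _ /\ _])); last first.
  by move=> K [KT Kx]; apply: xO; apply/closure_cell; exists K.
rewrite /bcoord (xgetPN _ (P := [set w | _]))// => w [_ + _].
by rewrite big_nil => /eqP; rewrite eq_sym oner_eq0.
Qed.

Lemma hat_ge0 z x : 0 <= hat z x.
Proof.
have [/closure_cell[K KT Kx]|xO] := pselect (closure Omega x).
  by rewrite (hat_cell z KT Kx); exact: cell_bcoord_ge0.
by rewrite hat_out.
Qed.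

Lemma hat_le1 z x : hat z x <= 1.
Proof.
have [/closure_cell[K KT Kx]|xO] := pselect (closure Omega x); last first.
  by rewrite hat_out.
rewrite (hat_cell z KT Kx); have [bN b1 _] := cell_bcoordP x KT.
have [zK|zK] := boolP (z \in K); last by rewrite bN.
rewrite -b1 (big_fsetD1 z zK) lerDl /=.
by apply: sumr_ge0 => y _; exact: cell_bcoord_ge0.
Qed.

Lemma hat_node z y : y \in nodes T -> hat z y = (y == z)%:R.
Proof.
move=> /nodeP[K KT yK]; rewrite (hat_cell z KT (conv_hull_vertex yK)).
by rewrite (cell_bcoordE KT (barycentric_vertex yK)) eq_sym.
Qed.

(** Continuity is obtained by gluing: finitely many closed cells cover the
    closure of the domain, and on each of them the function is affine. *)
Lemma hat_P1 z : P1 T (hat z : _ -> R^o).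
Proof.
split; last by move=> x; exact: hat_out.
- rewrite -(cells_cover T).
  rewrite bigcup_seq.
  suff [] : closed (\big[setU/set0]_(K <- cells T) conv_hull K) /\
     {within \big[setU/set0]_(K <- cells T) conv_hull K,
       continuous (hat z : _ -> R^o)} by [].
  rewrite big_seq; elim/big_ind : _ => [|A B [cA fA] [cB fB]|K KT].
  + by split; [exact: closed0|exact: continuous_subspace0].
  + by split; [exact: closedU|exact: withinU_continuous].
  + have cK := card_cell KT; have iK := cell_nondegenerate KT.
    split; first exact: conv_hull_closed.
    apply: (@subspace_eq_continuous _ _ _ (fun x => bcoord K x z : R^o)).
      by move=> x; rewrite inE => Kx; apply/esym; exact: hat_cell.
    apply: continuous_subspaceT; apply: affine_continuous; exact: bcoord_affine.
- move=> K KT.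
  have [L [b H]] := bcoord_affine (card_cell KT) (cell_nondegenerate KT) z.
  by exists L, b => x Kx; rewrite (hat_cell z KT Kx) H.
Qed.

Lemma nodal_basis_hat z : nodal_basis T z = hat z.
Proof.
have [Pb bz] : [set f : 'rV[R]_d -> R | @P1 R d Omega T R^o f /\
    forall z', z' \in nodes T -> f z' = (z' == z)%:R] (nodal_basis T z).
  apply: xgetPex; exists (hat z); split; first exact: hat_P1.
  exact: hat_node.
apply: (P1_eq Pb (hat_P1 z)) => y yT.
by rewrite bz// hat_node.
Qed.

Lemma nodal_interp_Vh v : Vh T (nodal_interp T v).
Proof.
apply: (@P1_sum 'rV[R]_3 _ (nodes T) (fun z x => nodal_basis T z x *: v z)) => z.
by rewrite nodal_basis_hat; exact: P1Zr (hat_P1 z).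
Qed.

Lemma nodal_interp_node v y : y \in nodes T -> nodal_interp T v y = v y.
Proof.
move=> yT; rewrite /nodal_interp (big_fsetD1 y yT) /=.
rewrite nodal_basis_hat hat_node// eqxx scale1r big_seq big1 ?addr0// => z.
rewrite !inE nodal_basis_hat hat_node// eq_sym => /andP[/negbTE -> _].
by rewrite scale0r.
Qed.

End P1.

(** * Positivity of the lumping weights *)

(** The integral of a nonnegative function is the supremum of the integrals of
    the simple functions below it, hence monotone. In this form the comparison
    applies to hat functions directly from their pointwise bounds. *)
Lemma ge0_le_integral_sub (disp : measure_display) (X : measurableType disp)
    (R : realType) (mu : {measure set X -> \bar R}) (A B : set X)
    (f g : X -> \bar R) :
  (forall x, 0 <= f x)%E -> (forall x, 0 <= g x)%E -> A `<=` B ->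
  (forall x, A x -> f x <= g x)%E ->
  (\int[mu]_(x in A) f x <= \int[mu]_(x in B) g x)%E.
Proof.
move=> f0 g0 AB fg; rewrite (integral_mkcond A) (integral_mkcond B).
have fA0 x : (0 <= (f \_ A) x)%E by rewrite erestrict_ge0.
have gB0 x : (0 <= (g \_ B) x)%E by rewrite erestrict_ge0.
rewrite !ge0_integralTE//; apply: ereal_sup_le => _ [s /= sf <-].
exists s => //= x; apply: le_trans (sf x) _; rewrite {1}/patch.
by case: ifPn => [/set_mem Ax|_ //]; rewrite patchT ?fg// inE; exact: AB.
Qed.

Section box.
Context {R : realType} {d : nat}.

(** The balls of the max norm, written as products of intervals so that their
    Lebesgue measure is known. *)
Definition cube (y : 'rV[R]_d) (e : R) : set 'rV[R]_d :=
  [set x | forall i, `]y 0 i - e, y 0 i + e[%classic (x 0 i)].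

Lemma measurable_cube y e : measurable (cube y e).
Proof.
rewrite (_ : cube y e = \bigcap_(i in [set: 'I_d])
    ((fun x : 'rV[R]_d => x 0 i : measurableTypeR R)
       @^-1` `]y 0 i - e, y 0 i + e[%classic)).
  apply: fin_bigcap_measurable => // i _.
  by rewrite -[X in measurable X]setTI; exact: measurable_rV_coord.
by apply/seteqP; split=> x /= Bx i; [move=> _|]; exact: Bx.
Qed.

Lemma lebesgue_cube y e : 0 < e ->
  lebesgue_rV d (cube y e) = ((e *+ 2) ^+ d)%:E.
Proof.
move=> e0.
rewrite (lebesgue_rV_box (A := fun i => `]y 0 i - e, y 0 i + e[%classic))//.
have side (i : 'I_d) : lebesgue_measure `]y 0 i - e, y 0 i + e[%classic = (e *+ 2)%:E.
  rewrite lebesgue_measure_itv /= lte_fin ltrD2l gtrN// -EFinB.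
  by congr EFin; ring.
under eq_bigr do rewrite side.
by rewrite prodEFin prodr_const card_ord.
Qed.

Lemma cube_ball y e x : 0 < e -> ball y e x <-> cube y e x.
Proof.
move=> e0; split=> [[_ yx] i|yx].
  have := yx 0 i; rewrite /ball /= /cube in_itv /= distrC ltr_distl//.
split=> // i j; rewrite ord1; have := yx j.
by rewrite /= in_itv /= /ball /= distrC ltr_distl.
Qed.

Lemma nbhs_cube (A : set 'rV[R]_d) y : nbhs y A ->
  exists2 e, 0 < e & cube y e `<=` A.
Proof.
move=> /nbhs_ballP[e /= e0 eA]; exists e => // x /cube_ball.
by move=> /(_ e0); exact: eA.
Qed.

Lemma bounded_cube (A : set 'rV[R]_d) : bounded_set A ->
  exists2 e, 0 < e & A `<=` cube 0 e.
Proof.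
(* Boundedness gives a bound for every number above [M], and the cube is open:
   each of the two needs its own margin of 1. *)
move=> [M [_ AM]]; pose N := Num.max M 0 + 1.
have [MN N0] : M < N /\ 0 < N by rewrite /N; split; rewrite ltr_pwDr// le_max lexx ?orbT.
exists (N + 1) => [|x Ax]; first exact: addr_gt0.
apply/cube_ball; first exact: addr_gt0.
by rewrite -ball_normE /= sub0r normrN (le_lt_trans (AM _ MN x Ax))// ltrDl.
Qed.

End box.

Section beta.
Context {R : realType} {d : nat} {Omega : set 'rV[R]_d}.
Variable T : triangulation Omega.
Hypotheses (openO : open Omega) (bndO : bounded_set Omega).

(** Near the centroid of a cell with vertex [z], all coordinates are positive
    and that of [z] is bounded below. The centroid is only known to lie in the
    closure of the domain, but every neighbourhood of it meets the domain, and
    a cube fits into the intersection. *)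
Lemma hat_cube z : z \in nodes T -> exists y e c,
  [/\ 0 < e, 0 < c & forall x, cube y e x -> Omega x /\ c <= hat T z x].
Proof.
move=> /nodeP[K KT zK].
have cK := card_cell KT; have iK := cell_nondegenerate KT.
have [x0 Kx0 x0gt0] := bcoord_interior cK iK.
pose c := bcoord K x0 z / 2.
have c0 : 0 < c by rewrite divr_gt0 ?x0gt0.
pose U := \bigcap_(u in [set` K])
  [set x | 0 < bcoord K x u] `&` [set x | c < bcoord K x z].
have cont u : continuous (fun x => bcoord K x u : R^o).
  by apply: affine_continuous; exact: bcoord_affine.
have nU : nbhs x0 U.
  apply: filterI.
    apply: filter_bigI => u uK.
    exact: (cont u x0 [set t : R | 0 < t] (lt_nbhsr (x0gt0 u uK))).
  apply: (cont z x0 [set t : R | c < t] (lt_nbhsr _)).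
  by rewrite ltr_pdivrMr// ltr_pMr ?x0gt0// ltr1n.
have [y [Oy Uy]] : Omega `&` U^° !=set0.
  have : closure Omega x0 by apply/(closure_cell T); exists K.
  by apply; exact: nbhs_interior.
have [e e0 eU] : exists2 e, 0 < e & cube y e `<=` Omega `&` U.
  by apply: nbhs_cube; apply: filterI => //; exact: open_nbhs_nbhs.
exists y, e, c; split=> // x /eU[Ox [Kx zx]]; split=> //.
rewrite (hat_cell z KT) ?ltW//; apply/(conv_hull_bcoord cK iK) => u.
have [uK|uK] := boolP (u \in K); first exact/ltW/Kx.
by have [-> //] := bcoordP cK iK x.
Qed.

(** The integral is at least that of a positive constant over a small cube, and at
    most the measure of a large cube. The upper bound is needed as well, since
    [fine] sends an infinite integral to 0. *)
Lemma beta_gt0 z : z \in nodes T -> 0 < beta T z.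
Proof.
move=> zT; rewrite /beta /Rintegral nodal_basis_hat.
have [y [e [c [e0 c0 H]]]] := hat_cube zT.
have [M M0 OM] := bounded_cube bndO.
apply: fine_gt0; apply/andP; split.
  rewrite (@lt_le_trans _ _ (\int[lebesgue_rV d]_(x in cube y e) (cst c%:E x))%E)//.
    rewrite integral_cst; last exact: measurable_cube.
    rewrite [X in (_ * X)%E](_ : _ = ((e *+ 2) ^+ d)%:E); last exact: lebesgue_cube.
    by rewrite mule_gt0// lte_fin ?exprn_gt0 ?pmulrn_lgt0.
  apply: (@ge0_le_integral_sub _ _ R (lebesgue_rV d)) => [x|x|x /H[]//|x /H[_ cx]].
  - by rewrite lee_fin ltW.
  - by rewrite lee_fin hat_ge0.
  - by rewrite lee_fin.
rewrite (@le_lt_trans _ _ (\int[lebesgue_rV d]_(x in cube 0 M) (cst 1%:E x))%E)//.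
  apply: (@ge0_le_integral_sub _ _ R (lebesgue_rV d)) => // x.
  - by rewrite lee_fin hat_ge0.
  - by rewrite lee_fin hat_le1.
rewrite integral_cst; last exact: measurable_cube.
rewrite [X in (_ * X)%E](_ : _ = ((M *+ 2) ^+ d)%:E); last exact: lebesgue_cube.
by rewrite mul1e ltry.
Qed.

End beta.

(** * The iteration *)

Section nodal.
Context {R : realType} {d : nat} {Omega : set 'rV[R]_d}.
Variable T : triangulation Omega.
Implicit Types u v w phi : 'rV[R]_d -> 'rV[R]_3.

(** At a point [x] of a cell, [v x] is a convex combination of nodal values;
    taking the dot product with [v x] itself bounds [q = dotv (v x) (v x)] by
    a weighted average of the numbers [dotv (v z) (v x)], each at most [(1 + q) / 2]. *)
Lemma Vh_dotv_le1 v : Vh T v ->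
  (forall z, z \in nodes T -> dotv (v z) (v z) <= 1) ->
  forall x, dotv (v x) (v x) <= 1.
Proof.
move=> Vv v1 x.
have [/(closure_cell T)[K KT Kx]|xO] := pselect (closure Omega x); last first.
  by case: Vv => _ _ ->//; rewrite -(scale0r 0) dotvZl mul0r.
have [_ b1 _] := cell_bcoordP x KT; set q := dotv (v x) (v x).
have : q <= (1 + q) / 2; last by lra.
have -> : (1 + q) / 2 = \sum_(z <- K) bcoord K x z * ((1 + q) / 2).
  by rewrite -mulr_suml b1 mul1r.
rewrite {1}/q {1}(P1_eval Vv KT Kx) dotv_suml big_seq [leRHS]big_seq.
apply: ler_sum => z zK; rewrite dotvZl.
apply: ler_wpM2l; first exact: (cell_bcoord_ge0 z KT Kx).
apply: le_trans (dotv_le_half _ _) _.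
rewrite ler_pM2r ?invr_gt0// lerD2r v1//.
by apply/nodeP; exists K.
Qed.

Lemma linfty_norm_le1 v : (forall x, dotv (v x) (v x) <= 1) ->
  (linfty_norm Omega v <= 1)%E.
Proof.
move=> v1; rewrite /linfty_norm unlock; case: ifP => // _.
apply/ess_supP; apply: nearW => x /=.
rewrite /patch; case: ifP => _; last by rewrite abse0.
by rewrite abse_EFin lee_fin ger0_norm ?sqrtr_ge0// enorm_le1.
Qed.

Lemma lumped_lin (a b : R) u v w phi :
  lumped T u phi + a * lumped T v phi + b * lumped T w phi =
  lumped T (fun x => u x + a *: v x + b *: w x) phi.
Proof.
rewrite /lumped !mulr_sumr -!big_split; apply: eq_bigr => z _ /=.
by rewrite !dotvDl !dotvZl; ring.
Qed.

(** For the direct implication, the test field concentrated at [z] in the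
    direction [j] isolates one component at one node, with the weight
    [beta T z]; the hypotheses on the domain ensure that it is nonzero. *)
Lemma lumped_testP u v : open Omega -> bounded_set Omega ->
  (forall phi, Vh T phi -> lumped T u phi = lumped T v phi) <->
  {in nodes T, u =1 v}.
Proof.
move=> oO bO; split=> [uv z zT|uv phi _]; last first.
  by rewrite /lumped big_seq [RHS]big_seq; apply: eq_bigr => z /uv ->.
pose phi j : 'rV[R]_d -> 'rV[R]_3 := fun x => hat T z x *: delta_mx 0 j.
have lumpedE w j : lumped T w (phi j) = beta T z * w z 0 j.
  rewrite /lumped (big_fsetD1 z zT) /= /phi hat_node// eqxx scale1r dotv_delta.
  rewrite big_seq big1 ?addr0// => y; rewrite !inE => /andP[/negbTE yz yT].
  by rewrite hat_node// yz scale0r dotvC -(scale0r 0) dotvZl mul0r mulr0.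
have b0 : beta T z != 0 by rewrite gt_eqF ?beta_gt0.
apply/rowP => j; apply: (mulfI b0); rewrite -!lumpedE; apply: uv.
exact: P1Zr (hat_P1 T z).
Qed.
End nodal.

Theorem lemma4p3 (R : realType) (d : nat) (hd : (1 <= d <= 3)%N)
  (Omega : set 'rV[R]_d) (hOmega : convex_polytopal_domain Omega)
  (Tend alpha gamma kappa_e kappa_d : R)
  (hTend : 0 < Tend) (halpha : 0 < alpha) (hgamma : 0 < gamma)
  (hkappa_e : 0 < kappa_e)
  (N : nat)
  (H : set R) (T : R -> triangulation Omega)
  (hT : mesh_family H T) (hT_shape : shape_regular H T)
  (hT_quasi : quasi_uniform H T)
  (lambda c_lambda : R) (hlambda : 0 < lambda) (hc_lambda : 0 < c_lambda)
  (hcoercive : forall h v, H h -> Vh (T h) v ->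
     c_lambda * h1_norm Omega v ^+ 2
     <= form_a_lambda (T h) kappa_e kappa_d lambda v v)
  (h : R) (hH : H h)
  (i : nat) (hi : (i < N)%N)
  (m : 'rV[R]_d -> 'rV[R]_3) (hm : Mh (T h) m)
  (eps : nat -> R) (heps : 0 < eps i.+1) :
  let k := Tend / N%:R in
  let Hhl := Hh (T h) kappa_e kappa_d lambda in
  let solves (eta eta' : 'rV[R]_d -> 'rV[R]_3) :=
    Vh (T h) eta' /\
    forall phi, Vh (T h) phi ->
      lumped (T h) eta' phi
      + alpha * lumped (T h) (fun x => crossv (eta' x) (m x)) phi
      + gamma * k / 2 *
          lumped (T h) (fun x => crossv (eta' x) (Hhl eta x)) phi
      = lumped (T h) m phi in
  let stops (eta eta' : 'rV[R]_d -> 'rV[R]_3) :=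
    lumped_norm (T h) (nodal_interp (T h) (fun x =>
      crossv (eta' x) (Hhl (fun y => eta' y - eta y) x))) <= eps i.+1 in
  exists eta : nat -> 'rV[R]_d -> 'rV[R]_3,
    [/\ eta 0%N = m,
        forall l, unique (solves (eta l)) (eta l.+1),
        forall l, (linfty_norm Omega (eta l.+1) <= 1)%E &
        forall lstar, stops (eta lstar) (eta lstar.+1) ->
          (forall l, (l < lstar)%N -> ~ stops (eta l) (eta l.+1)) ->
          Mh (T h) (fun x => 2 *: eta lstar.+1 x - m x)].
Proof.
move=> k Hhl solves stops.
have [_ oO bO _ _] := hOmega; have [Vm m1] := hm.
have {}m1 z : z \in nodes (T h) -> dotv (m z) (m z) = 1.
  by move=> zT; apply/enorm_eq1; exact: m1.
(* The coefficients of the two cross product terms merge into one vector,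
   since the cross product is linear in its second argument. *)
pose b (u : 'rV[R]_d -> 'rV[R]_3) z := alpha *: m z + gamma * k / 2 *: Hhl u z.
have solvesP u v : solves u v <-> Vh (T h) v /\
    forall z, z \in nodes (T h) -> v z + crossv (v z) (b u z) = m z.
  pose lhs x := v x + alpha *: crossv (v x) (m x)
    + (gamma * k / 2) *: crossv (v x) (Hhl u x).
  have lhsE z : v z + crossv (v z) (b u z) = lhs z.
    by rewrite /b crossvDr !crossvZr addrA.
  have testP := @lumped_testP _ _ _ (T h) lhs m oO bO.
  split=> -[Vv eqv]; split=> //.
    move=> z zT; rewrite lhsE; apply: testP.1 z zT => phi Vphi.
    by rewrite -eqv// lumped_lin.
  move=> phi Vphi; rewrite lumped_lin; apply: testP.2 Vphi => z zT.
  by rewrite -lhsE eqv.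
pose step u := nodal_interp (T h) (fun z => cross_resolvent (b u z) (m z)).
have stepP u : solves u (step u).
  apply/solvesP; split=> [|z zT]; first exact: nodal_interp_Vh.
  by rewrite /step nodal_interp_node// cross_resolventP.
pose eta l := iter l step m.
have etaP l z : z \in nodes (T h) ->
    eta l.+1 z + crossv (eta l.+1 z) (b (eta l) z) = m z.
  by have /solvesP[_] := stepP (eta l); apply.
have Veta l : Vh (T h) (eta l.+1) by exact: nodal_interp_Vh.
exists eta; split=> // [l|l|l _ _].
- split=> [|v /solvesP[Vv eqv]]; first exact: stepP.
  apply: (P1_eq (Veta l) Vv) => z zT.
  exact: cross_resolvent_unique (etaP l z zT) (eqv z zT).
- apply: linfty_norm_le1; apply: Vh_dotv_le1 => [|z zT]; first exact: Veta.
  exact: cross_resolvent_le1 (etaP l z zT) (m1 z zT).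
- split=> [|z zT].
    have := P1D (P1Zl 2 (Veta l)) (P1Zl (-1) Vm).
    by congr (Vh _ _); apply/funext => x; rewrite scaleN1r.
  by apply/enorm_eq1; rewrite (cross_resolvent_reflect (etaP l z zT)) m1.
Qed.
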